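(* Let $n\ge 1$, let $(S^3_q)^n$ be a free right $S^3_q$-module with basis $\{e_i\}_{i=1}^n$, and let $\nabla$ be a right $q$-affine connection on $(S^3_q)^n$ given by the Christoffel symbols $\Gamma^j_{ai}\in S^3_q$, i.e. $\nabla_{X_a}e_i=\sum_{j} e_j\Gamma^j_{ai}$ for $a\in\{+,-,z\}$ and $i=1,\dots,n$. Let $h$ be an invertible hermitian form on $(S^3_q)^n$, set $h_{ij}=h(e_i,e_j)$, and let $h^{ij}\in S^3_q$ be the entries of the inverse matrix, $\sum_j h^{ij}h_{jk}=\delta^i_k\mathbf{1}$. Then $\nabla$ is compatible with $h$ if and only if there exist $\gamma_{ij},\rho_{ij}\in S^3_q$ ($i,j=1,\dots,n$) such that $\rho_{ij}^*=\rho_{ji}$ and, for all $i,j$, $$\Gamma^i_{+j}=\sum_k h^{ik}\big(\tfrac12 X_+(h_{kj})+K(\gamma_{kj})\big),$$ $$\Gamma^i_{-j}=\sum_k h^{ik}\big(\tfrac12 X_-(h_{kj})+K(\gamma_{jk}^* )\big),$$ $$\Gamma^i_{zj}=\sum_k h^{ik}\big(\tfrac12 X_z(h_{kj})+K^2(\rho_{kj})\big).$$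
   Context: Let $q>0$ be real, $q\neq 1$. $S^3_q$ is the unital complex $*$-algebra generated by $a,a^*,c,c^*$ with relations $ac=qca$, $c^*a^*=qa^*c^*$, $ac^*=qc^*a$, $ca^*=qa^*c$, $cc^*=c^*c$, $a^*a+c^*c=aa^*+q^2cc^*=\mathbf 1$. $\mathcal U_q(\mathrm{su}(2))$ is the algebra generated by $E,F,K,K^{-1}$ with $K^{\pm1}E=q^{\pm1}EK^{\pm1}$, $K^{\pm1}F=q^{\mp1}FK^{\pm1}$, $[E,F]=\frac{K^2-K^{-2}}{q-q^{-1}}$, and coproduct $\Delta(E)=E\otimes K+K^{-1}\otimes E$, $\Delta(F)=F\otimes K+K^{-1}\otimes F$, $\Delta(K^{\pm1})=K^{\pm1}\otimes K^{\pm1}$ (counit $\epsilon(K)=1$, $\epsilon(E)=\epsilon(F)=0$). It acts on $S^3_q$ from the left; the action is written $h(f)$ (or $h\triangleright f$), makes $S^3_q$ a left module algebra, $h(fg)=h_{(1)}(f)\,h_{(2)}(g)$ and $h(\mathbf 1)=\epsilon(h)\mathbf 1$, and is determined by $K^{\pm1}(a)=q^{\mp1/2}a$, $K^{\pm1}(c)=q^{\mp1/2}c$, $K^{\pm1}(a^* )=q^{\pm1/2}a^*$, $K^{\pm1}(c^* )=q^{\pm1/2}c^*$; $E(a)=-qc^*$, $E(c)=a^*$, $E(a^* )=E(c^* )=0$; $F(a)=F(c)=0$, $F(a^* )=c$, $F(c^* )=-q^{-1}a$. Set $X_+=\sqrt q\,EK$, $X_-=\frac1{\sqrt q}FK$,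 $X_z=\frac{1-K^4}{1-q^{-2}}$, and $\sigma_+=\sigma_-=K^2$, $\sigma_z=K^4$, all acting on $S^3_q$ by the left action; then $X_a(fg)=fX_a(g)+X_a(f)\sigma_a(g)$ for $a\in\{+,-,z\}$. The quantum tangent space $TS^3_q$ is the complex vector space spanned by $X_+,X_-,X_z$. A right $q$-affine connection on a right $S^3_q$-module $M$ is a map $\nabla:TS^3_q\times M\to M$, $(X,m)\mapsto\nabla_Xm$, that is $\mathbb C$-linear in each argument and satisfies $\nabla_{X_a}(mf)=(\nabla_{X_a}m)\sigma_a(f)+mX_a(f)$ for $a\in\{+,-,z\}$, $m\in M$, $f\in S^3_q$. A hermitian form on a right $S^3_q$-module $M$ is a map $h:M\times M\to S^3_q$ with $h(m_1,m_2f)=h(m_1,m_2)f$, $h(m_1,m_2)^*=h(m_2,m_1)$ and $h(m_1+m_2,m_3)=h(m_1,m_3)+h(m_2,m_3)$. It is invertible if the map $\hat h:M\to M^*$ (dual module), $\hat h(m_1)(m_2)=h(m_1,m_2)$, is bijective. $\nabla$ is compatible with $h$ if for all $m_1,m_2\in M$: $X_+(h(m_1,m_2))=h(m_1,\nabla_{X_+}m_2)-K^2\big(h(\nabla_{X_-}m_1,m_2)\big)$, $X_-(h(m_1,m_2))=h(m_1,\nabla_{X_-}m_2)-K^2\big(h(\nabla_{X_+}m_1,m_2)\big)$, $X_z(h(m_1,m_2))=h(m_1,\nabla_{X_z}m_2)-K^4\big(h(\nabla_{X_z}m_1,m_2)\big)$. *)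

(* Defs.v *)
From HB Require Import structures.
From mathcomp Require Import all_boot all_order all_algebra.
From mathcomp Require Import generic_quotient.
From mathcomp Require Import boolp reals.
From mathcomp Require Import complex ring.

Set Implicit Arguments.
Unset Strict Implicit.
Unset Printing Implicit Defensive.

Import Order.TTheory GRing.Theory Num.Theory.
Local Open Scope ring_scope.
Local Open Scope quotient_scope.

Inductive ncterm (K G : Type) : Type :=
  | TGen of G
  | TCst of K
  | TAdd of ncterm K G & ncterm K G
  | TMul of ncterm K G & ncterm K G.

Arguments TGen {K G} _.
Arguments TCst {K G} _.

HB.instance Definition _ (K G : Type) := gen_eqMixin (ncterm K G).
HB.instance Definition _ (K G : Type) := gen_choiceMixin (ncterm K G).

Declare Scope ncterm_scope.
Delimit Scope ncterm_scope with nct.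
Bind Scope ncterm_scope with ncterm.
Notation "s + t" := (TAdd s t) : ncterm_scope.
Notation "s * t" := (TMul s t) : ncterm_scope.
Notation "k *: t" := (TMul (TCst k) t) : ncterm_scope.

(* The smallest congruence on terms containing the axioms of unital            *)
(* associative K-algebras and the relations in rel: its quotient is the        *)
(* K-algebra with generators G and defining relations rel.                     *)
Inductive alg_cong (K : comNzRingType) (G : Type)
    (rel : ncterm K G -> ncterm K G -> Prop) :
    ncterm K G -> ncterm K G -> Prop :=
  | ac_rel s t : rel s t -> alg_cong rel s t
  | ac_refl s : alg_cong rel s s
  | ac_sym s t : alg_cong rel s t -> alg_cong rel t s
  | ac_trans s t u : alg_cong rel s t -> alg_cong rel t u -> alg_cong rel s u
  | ac_add s s' t t' : alg_cong rel s s' -> alg_cong rel t t' ->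
      alg_cong rel (s + t)%nct (s' + t')%nct
  | ac_mul s s' t t' : alg_cong rel s s' -> alg_cong rel t t' ->
      alg_cong rel (s * t)%nct (s' * t')%nct
  | ac_addA s t u : alg_cong rel (s + (t + u))%nct (s + t + u)%nct
  | ac_addC s t : alg_cong rel (s + t)%nct (t + s)%nct
  | ac_add0 s : alg_cong rel (TCst 0 + s)%nct s
  | ac_addN s : alg_cong rel (-1 *: s + s)%nct (TCst 0)
  | ac_mulA s t u : alg_cong rel (s * (t * u))%nct (s * t * u)%nct
  | ac_mul1 s : alg_cong rel (1 *: s)%nct s
  | ac_mulDl s t u : alg_cong rel ((s + t) * u)%nct (s * u + t * u)%nct
  | ac_mulDr s t u : alg_cong rel (s * (t + u))%nct (s * t + s * u)%nct
  | ac_cstD k l : alg_cong rel (TCst (k + l)) (TCst k + TCst l)%nct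
  | ac_cstM k l : alg_cong rel (TCst (k * l)) (k *: TCst l)%nct
  | ac_cstC k s : alg_cong rel (k *: s)%nct (s * TCst k)%nct.

Section PresentedAlgebra.
Variables (K : comNzRingType) (G : Type).
Variable rel : ncterm K G -> ncterm K G -> Prop.
Implicit Types (s t u : ncterm K G) (k l : K).

Definition alg_congb s t := `[< alg_cong rel s t >].

Lemma alg_congb_equiv : equiv_class_of alg_congb.
Proof.
split=> [s|s t|t s u]; first by apply/asboolP; exact: ac_refl.
  by apply/asboolP/asboolP; exact: ac_sym.
move=> /asboolP st /asboolP tu; apply/asboolP; exact: ac_trans st tu.
Qed.

Canonical alg_cong_equiv := EquivRelPack alg_congb_equiv.

Definition palg := {eq_quot alg_cong_equiv}.

HB.instance Definition _ := Choice.on palg.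
HB.instance Definition _ := EqQuotient.on palg.

Definition palg_class (s : ncterm K G) : palg := \pi_palg s.

Lemma palg_classP s t : palg_class s = palg_class t <-> alg_cong rel s t.
Proof.
rewrite /palg_class; split; first by move/eqmodP/asboolP.
by move=> st; apply/eqmodP/asboolP.
Qed.

Lemma palg_repr s : alg_cong rel (repr (palg_class s)) s.
Proof. by apply/palg_classP; rewrite /palg_class reprK. Qed.

Lemma palg_ind (P : palg -> Prop) :
  (forall s, P (palg_class s)) -> forall x, P x.
Proof. by move=> Ps x; rewrite -[x]reprK; exact: Ps. Qed.

Definition palg_add (x y : palg) : palg := palg_class (repr x + repr y)%nct.
Definition palg_mul (x y : palg) : palg := palg_class (repr x * repr y)%nct.
Definition palg_scale k (x : palg) : palg := palg_class (k *: repr x)%nct.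
Definition palg_opp : palg -> palg := palg_scale (-1).

Lemma palg_addE s t :
  palg_add (palg_class s) (palg_class t) = palg_class (s + t)%nct.
Proof. by apply/palg_classP; apply: ac_add; exact: palg_repr. Qed.

Lemma palg_mulE s t :
  palg_mul (palg_class s) (palg_class t) = palg_class (s * t)%nct.
Proof. by apply/palg_classP; apply: ac_mul; exact: palg_repr. Qed.

Lemma palg_scaleE k s : palg_scale k (palg_class s) = palg_class (k *: s)%nct.
Proof.
by apply/palg_classP; apply: ac_mul; [exact: ac_refl|exact: palg_repr].
Qed.

Fact palg_addA : associative palg_add.
Proof.
elim/palg_ind=> s; elim/palg_ind=> t; elim/palg_ind=> u.
by rewrite !palg_addE; apply/palg_classP; exact: ac_addA.
Qed.

Fact palg_addC : commutative palg_add.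
Proof.
elim/palg_ind=> s; elim/palg_ind=> t.
by rewrite !palg_addE; apply/palg_classP; exact: ac_addC.
Qed.

Fact palg_add0 : left_id (palg_class (TCst 0)) palg_add.
Proof.
by elim/palg_ind=> s; rewrite palg_addE; apply/palg_classP; exact: ac_add0.
Qed.

Fact palg_addN : left_inverse (palg_class (TCst 0)) palg_opp palg_add.
Proof.
elim/palg_ind=> s; rewrite /palg_opp palg_scaleE palg_addE.
by apply/palg_classP; exact: ac_addN.
Qed.

HB.instance Definition _ :=
  GRing.isZmodule.Build palg palg_addA palg_addC palg_add0 palg_addN.

Lemma palg_classD s t : palg_class (s + t)%nct = palg_class s + palg_class t.
Proof. by rewrite -palg_addE. Qed.

Fact palg_mulA : associative palg_mul.
Proof.
elim/palg_ind=> s; elim/palg_ind=> t; elim/palg_ind=> u.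
by rewrite !palg_mulE; apply/palg_classP; exact: ac_mulA.
Qed.

Fact palg_mul1 : left_id (palg_class (TCst 1)) palg_mul.
Proof.
by elim/palg_ind=> s; rewrite palg_mulE; apply/palg_classP; exact: ac_mul1.
Qed.

Fact palg_mulr1 : right_id (palg_class (TCst 1)) palg_mul.
Proof.
elim/palg_ind=> s; rewrite palg_mulE; apply/palg_classP.
by apply: ac_trans (ac_mul1 _ s); apply: ac_sym; exact: ac_cstC.
Qed.

Fact palg_mulDl : left_distributive palg_mul +%R.
Proof.
elim/palg_ind=> s; elim/palg_ind=> t; elim/palg_ind=> u.
by rewrite -palg_classD !palg_mulE -palg_classD; apply/palg_classP;
  exact: ac_mulDl.
Qed.

Fact palg_mulDr : right_distributive palg_mul +%R.
Proof.
elim/palg_ind=> s; elim/palg_ind=> t; elim/palg_ind=> u.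
by rewrite -palg_classD !palg_mulE -palg_classD; apply/palg_classP;
  exact: ac_mulDr.
Qed.

HB.instance Definition _ := GRing.Zmodule_isPzRing.Build palg
  palg_mulA palg_mul1 palg_mulr1 palg_mulDl palg_mulDr.

Lemma palg_classM s t : palg_class (s * t)%nct = palg_class s * palg_class t.
Proof. by rewrite -palg_mulE. Qed.

Lemma palg_class1 : palg_class (TCst 1) = 1.
Proof. by []. Qed.

Fact palg_scaleA k l x : palg_scale k (palg_scale l x) = palg_scale (k * l) x.
Proof.
elim/palg_ind: x => s; rewrite !palg_scaleE; apply/palg_classP.
apply: ac_trans (ac_mulA _ _ _ _) _.
by apply: ac_mul (ac_refl _ _); apply: ac_sym; exact: ac_cstM.
Qed.

Fact palg_scale1 : left_id 1 palg_scale.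
Proof.
by elim/palg_ind=> s; rewrite palg_scaleE; apply/palg_classP; exact: ac_mul1.
Qed.

Fact palg_scaleDr : right_distributive palg_scale +%R.
Proof.
move=> k; elim/palg_ind=> s; elim/palg_ind=> t.
by rewrite -palg_classD !palg_scaleE -palg_classD; apply/palg_classP;
  exact: ac_mulDr.
Qed.

Fact palg_scaleDl x : {morph palg_scale^~ x : k l / k + l}.
Proof.
move=> k l; elim/palg_ind: x => s.
rewrite !palg_scaleE -palg_classD; apply/palg_classP.
by apply: ac_trans (ac_mulDl _ _ _ _); apply: ac_mul (ac_refl _ _);
  exact: ac_cstD.
Qed.

HB.instance Definition _ := GRing.Zmodule_isLmodule.Build K palg
  palg_scaleA palg_scale1 palg_scaleDr palg_scaleDl.

Lemma palg_classZ k s : palg_class (k *: s)%nct = k *: palg_class s.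
Proof. by rewrite -palg_scaleE. Qed.

Lemma palg_classC k : palg_class (TCst k) = k *: (1 : palg).
Proof.
rewrite -palg_class1 -palg_classZ; apply/palg_classP.
by rewrite -{1}[k]mulr1; exact: ac_cstM.
Qed.

Lemma palg_scaleAl k (x y : palg) : k *: (x * y) = k *: x * y.
Proof.
elim/palg_ind: x => s; elim/palg_ind: y => t.
rewrite -palg_classM -!palg_classZ -palg_classM.
by apply/palg_classP; exact: ac_mulA.
Qed.

Lemma palg_scaleAr k (x y : palg) : k *: (x * y) = x * (k *: y).
Proof.
elim/palg_ind: x => s; elim/palg_ind: y => t.
rewrite -palg_classM -!palg_classZ -palg_classM; apply/palg_classP.
apply: ac_trans (ac_mulA _ _ _ _) _.
apply: ac_trans (ac_sym (ac_mulA _ _ _ _)).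
by apply: ac_mul (ac_refl _ _); exact: ac_cstC.
Qed.

Fixpoint term_char (chi : G -> K) s : K :=
  match s with
  | TGen g => chi g
  | TCst k => k
  | TAdd s t => term_char chi s + term_char chi t
  | TMul s t => term_char chi s * term_char chi t
  end.

Lemma palg_nonzero (chi : G -> K) :
    (forall s t, rel s t -> term_char chi s = term_char chi t) ->
  (1 : palg) != 0.
Proof.
move=> chi_rel; apply/eqP => /palg_classP.
suff H s t : alg_cong rel s t -> term_char chi s = term_char chi t.
  by move/H => /eqP; rewrite oner_eq0.
elim=> //=.
- by move=> s1 t1 u _ -> _ ->.
- by move=> s1 s2 t1 t2 _ -> _ ->.
- by move=> s1 s2 t1 t2 _ -> _ ->.
- by move=> *; rewrite addrA.
- by move=> *; rewrite addrC.
- by move=> *; rewrite add0r.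
- by move=> *; rewrite mulN1r addNr.
- by move=> *; rewrite mulrA.
- by move=> *; rewrite mul1r.
- by move=> *; rewrite mulrDl.
- by move=> *; rewrite mulrDr.
- by move=> *; rewrite mulrC.
Qed.

End PresentedAlgebra.

Inductive s3_gen := s3_a | s3_as | s3_c | s3_cs.

Section S3q.
Variables (R : realType) (q : R).
Local Notation C := R[i].
Local Notation qC := (real_complex R q).
Local Notation term := (ncterm C s3_gen).
Local Notation ta := (@TGen C s3_gen s3_a).
Local Notation tas := (@TGen C s3_gen s3_as).
Local Notation tc := (@TGen C s3_gen s3_c).
Local Notation tcs := (@TGen C s3_gen s3_cs).

Inductive s3_rel : term -> term -> Prop :=
  | s3_ac : s3_rel (ta * tc)%nct (qC *: (tc * ta))%nct
  | s3_csas : s3_rel (tcs * tas)%nct (qC *: (tas * tcs))%nct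
  | s3_acs : s3_rel (ta * tcs)%nct (qC *: (tcs * ta))%nct
  | s3_cas : s3_rel (tc * tas)%nct (qC *: (tas * tc))%nct
  | s3_ccs : s3_rel (tc * tcs)%nct (tcs * tc)%nct
  | s3_asa : s3_rel (tas * ta + tcs * tc)%nct (TCst 1)
  | s3_aas : s3_rel (ta * tas + qC ^+ 2 *: (tc * tcs))%nct (TCst 1).

Definition S3q := palg s3_rel.

HB.instance Definition _ := GRing.PzRing.on S3q.
HB.instance Definition _ := GRing.Lmodule.on S3q.

Fact S3q_nonzero : (1 : S3q) != 0.
Proof.
apply: (@palg_nonzero _ _ s3_rel
  (fun g => if g is (s3_a | s3_as) then 1 else 0)).
by move=> s t []; rewrite /= ?(mulr0, mul0r, mulr1, addr0).
Qed.

HB.instance Definition _ :=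
  GRing.PzSemiRing_isNonZero.Build S3q S3q_nonzero.
HB.instance Definition _ :=
  GRing.LSemiModule_isLSemiAlgebra.Build C S3q (@palg_scaleAl _ _ s3_rel).
HB.instance Definition _ :=
  GRing.LSemiAlgebra_isSemiAlgebra.Build C S3q (@palg_scaleAr _ _ s3_rel).

Definition S3a : S3q := palg_class s3_rel ta.
Definition S3as : S3q := palg_class s3_rel tas.
Definition S3c : S3q := palg_class s3_rel tc.
Definition S3cs : S3q := palg_class s3_rel tcs.

Definition star_gen (g : s3_gen) : s3_gen :=
  match g with s3_a => s3_as | s3_as => s3_a | s3_c => s3_cs | s3_cs => s3_c end.

Local Arguments conjc : simpl never.

Fixpoint star_term (t : term) : term :=
  match t with
  | TGen g => TGen (star_gen g)
  | TCst k => TCst (conjc k)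
  | TAdd s t => TAdd (star_term s) (star_term t)
  | TMul s t => TMul (star_term t) (star_term s)
  end.

Definition star (x : S3q) : S3q := palg_class s3_rel (star_term (repr x)).

Fact star_cong s t :
  alg_cong s3_rel s t -> alg_cong s3_rel (star_term s) (star_term t).
Proof.
have conjq (r : R) : conjc (real_complex R r) = real_complex R r.
  by rewrite /conjc /= oppr0.
elim=> /=.
- have qsym (k : R) s0 u v : alg_cong s3_rel s0 (real_complex R k *: (u * v))%nct ->
      alg_cong s3_rel s0 (u * v * TCst (conjc (real_complex R k)))%nct.
    by rewrite conjq => H; apply: ac_trans H _; exact: ac_cstC.
  move=> {}s {}t [] /=; rewrite ?rmorph1.
  + by apply: qsym; apply: ac_rel; exact: s3_csas.
  + by apply: qsym; apply: ac_rel; exact: s3_ac.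
  + by apply: qsym; apply: ac_rel; exact: s3_cas.
  + by apply: qsym; apply: ac_rel; exact: s3_acs.
  + by apply: ac_rel; exact: s3_ccs.
  + by apply: ac_rel; exact: s3_asa.
  + apply: ac_trans (ac_rel s3_aas); apply: ac_add (ac_refl _ _) _.
    rewrite rmorphXn /= conjq; apply: ac_sym; exact: ac_cstC.
- by move=> *; exact: ac_refl.
- by move=> *; exact: ac_sym.
- by move=> s1 t1 u _ + _; exact: ac_trans.
- by move=> *; exact: ac_add.
- by move=> *; exact: ac_mul.
- by move=> *; exact: ac_addA.
- by move=> *; exact: ac_addC.
- by move=> *; rewrite rmorph0; exact: ac_add0.
- move=> *; rewrite rmorph0 rmorphN1.
  apply: ac_trans (ac_addN _ _); apply: ac_add (ac_refl _ _).
  by apply: ac_sym; exact: ac_cstC.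
- by move=> *; apply: ac_sym; exact: ac_mulA.
- move=> s0; rewrite rmorph1; apply: ac_trans (ac_mul1 _ _).
  by apply: ac_sym; exact: ac_cstC.
- by move=> *; exact: ac_mulDr.
- by move=> *; exact: ac_mulDl.
- by move=> *; rewrite rmorphD; exact: ac_cstD.
- by move=> k l; rewrite mulrC rmorphM; exact: ac_cstM.
- by move=> k s0; apply: ac_sym; exact: ac_cstC.
Qed.

Lemma star_class t :
  star (palg_class s3_rel t) = palg_class s3_rel (star_term t).
Proof. by apply/palg_classP/star_cong; exact: palg_repr. Qed.

Lemma starK : involutive star.
Proof.
elim/palg_ind=> s; rewrite !star_class; congr palg_class.
elim: s => [[]|k|s IHs t IHt|s IHs t IHt] //=; rewrite ?conjcK //.
  by rewrite IHs IHt.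
by rewrite IHs IHt.
Qed.

Lemma starD : {morph star : x y / x + y}.
Proof.
elim/palg_ind=> s; elim/palg_ind=> t.
by rewrite -palg_classD !star_class -palg_classD.
Qed.

Lemma starM x y : star (x * y) = star y * star x.
Proof.
elim/palg_ind: x => s; elim/palg_ind: y => t.
by rewrite -palg_classM !star_class -palg_classM.
Qed.

Lemma starZ k x : star (k *: x) = conjc k *: star x.
Proof.
elim/palg_ind: x => s; rewrite -palg_classZ !star_class -palg_classZ.
by apply/palg_classP; apply: ac_sym; exact: ac_cstC.
Qed.

Lemma star1 : star 1 = 1.
Proof. by rewrite -[LHS]mulr1 -{2}[1]starK -starM mulr1 starK. Qed.

Lemma star_a : star S3a = S3as. Proof. exact: star_class. Qed.
Lemma star_c : star S3c = S3cs. Proof. exact: star_class. Qed.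

End S3q.

Inductive uq_gen := uq_E | uq_F | uq_K | uq_Ki.

Section Uq.
Variables (R : realType) (q : R).
Local Notation C := R[i].
Local Notation qC := (real_complex R q).
Local Notation term := (ncterm C uq_gen).
Local Notation tE := (@TGen C uq_gen uq_E).
Local Notation tF := (@TGen C uq_gen uq_F).
Local Notation tK := (@TGen C uq_gen uq_K).
Local Notation tKi := (@TGen C uq_gen uq_Ki).

Inductive uq_rel : term -> term -> Prop :=
  | uq_KKi : uq_rel (tK * tKi)%nct (TCst 1)
  | uq_KiK : uq_rel (tKi * tK)%nct (TCst 1)
  | uq_KE : uq_rel (tK * tE)%nct (qC *: (tE * tK))%nct
  | uq_KiE : uq_rel (tKi * tE)%nct (qC^-1 *: (tE * tKi))%nct
  | uq_KF : uq_rel (tK * tF)%nct (qC^-1 *: (tF * tK))%nct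
  | uq_KiF : uq_rel (tKi * tF)%nct (qC *: (tF * tKi))%nct
  | uq_EF : uq_rel (tE * tF + -1 *: (tF * tE))%nct
      ((qC - qC^-1)^-1 *: (tK * tK + -1 *: (tKi * tKi)))%nct.

Definition Uq := palg uq_rel.

HB.instance Definition _ := GRing.PzRing.on Uq.
HB.instance Definition _ := GRing.Lmodule.on Uq.

Fact Uq_nonzero : (1 : Uq) != 0.
Proof.
apply: (@palg_nonzero _ _ uq_rel
  (fun g => if g is (uq_K | uq_Ki) then 1 else 0)).
by move=> s t []; rewrite /= ?(mulr0, mul0r, mulr1, addr0, subrr).
Qed.

HB.instance Definition _ :=
  GRing.PzSemiRing_isNonZero.Build Uq Uq_nonzero.
HB.instance Definition _ :=
  GRing.LSemiModule_isLSemiAlgebra.Build C Uq (@palg_scaleAl _ _ uq_rel).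
HB.instance Definition _ :=
  GRing.LSemiAlgebra_isSemiAlgebra.Build C Uq (@palg_scaleAr _ _ uq_rel).

Definition UE : Uq := palg_class uq_rel tE.
Definition UF : Uq := palg_class uq_rel tF.
Definition UK : Uq := palg_class uq_rel tK.
Definition UKi : Uq := palg_class uq_rel tKi.

Local Notation S := (S3q q).
Local Notation sqrtqC := (real_complex R (Num.sqrt q)).

(* The left S^3_q-module algebra structure. As the coproduct and the counit    *)
(* are algebra morphisms, h(fg) = h_(1)(f) h_(2)(g) and h(1) = eps(h) 1 for    *)
(* all h amount to the same rules for the generators h = E, F, K, K^-1.        *)
Record uq_action := UqAction {
  uq_act :> Uq -> S -> S;
  uq_actDl : forall u v f, uq_act (u + v) f = uq_act u f + uq_act v f;
  uq_actZl : forall k u f, uq_act (k *: u) f = k *: uq_act u f;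
  uq_actDr : forall u f g, uq_act u (f + g) = uq_act u f + uq_act u g;
  uq_actZr : forall k u f, uq_act u (k *: f) = k *: uq_act u f;
  uq_act1 : forall f, uq_act 1 f = f;
  uq_actM : forall u v f, uq_act (u * v) f = uq_act u (uq_act v f);
  uq_actE_mul : forall f g,
    uq_act UE (f * g) = uq_act UE f * uq_act UK g + uq_act UKi f * uq_act UE g;
  uq_actF_mul : forall f g,
    uq_act UF (f * g) = uq_act UF f * uq_act UK g + uq_act UKi f * uq_act UF g;
  uq_actK_mul : forall f g, uq_act UK (f * g) = uq_act UK f * uq_act UK g;
  uq_actKi_mul : forall f g, uq_act UKi (f * g) = uq_act UKi f * uq_act UKi g;
  uq_actE_one : uq_act UE 1 = 0;
  uq_actF_one : uq_act UF 1 = 0;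
  uq_actK_one : uq_act UK 1 = 1;
  uq_actKi_one : uq_act UKi 1 = 1;
  uq_actK_a : uq_act UK (S3a q) = sqrtqC^-1 *: S3a q;
  uq_actK_c : uq_act UK (S3c q) = sqrtqC^-1 *: S3c q;
  uq_actK_as : uq_act UK (S3as q) = sqrtqC *: S3as q;
  uq_actK_cs : uq_act UK (S3cs q) = sqrtqC *: S3cs q;
  uq_actKi_a : uq_act UKi (S3a q) = sqrtqC *: S3a q;
  uq_actKi_c : uq_act UKi (S3c q) = sqrtqC *: S3c q;
  uq_actKi_as : uq_act UKi (S3as q) = sqrtqC^-1 *: S3as q;
  uq_actKi_cs : uq_act UKi (S3cs q) = sqrtqC^-1 *: S3cs q;
  uq_actE_a : uq_act UE (S3a q) = - qC *: S3cs q;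
  uq_actE_c : uq_act UE (S3c q) = S3as q;
  uq_actE_as : uq_act UE (S3as q) = 0;
  uq_actE_cs : uq_act UE (S3cs q) = 0;
  uq_actF_a : uq_act UF (S3a q) = 0;
  uq_actF_c : uq_act UF (S3c q) = 0;
  uq_actF_as : uq_act UF (S3as q) = S3c q;
  uq_actF_cs : uq_act UF (S3cs q) = - qC^-1 *: S3a q
}.

End Uq.

Module UqAction_exists.

Lemma grp (V : zmodType) (a x y p w q : V) :
  (a + x) + (y + p) - ((w + y) + (x + q)) = (a - w) + (p - q).
Proof.
rewrite (addrACA a x) opprD (addrACA (a + y)).
rewrite (opprD w) (addrACA a y) subrr addr0 (opprD x) (addrACA x p).
by rewrite subrr add0r.
Qed.

Section Action.
Variables (R : realType) (q : R).
Hypotheses (q_gt0 : 0 < q) (q_neq1 : q != 1).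
Local Notation C := R[i].
Local Notation S := (S3q q).
Local Notation term := (ncterm C s3_gen).
Local Notation cl := (palg_class (s3_rel q)).
Local Notation qC := (real_complex R q).
Local Notation s := (real_complex R (Num.sqrt q)).
Local Notation a := (S3a q).
Local Notation as_ := (S3as q).
Local Notation c := (S3c q).
Local Notation cs := (S3cs q).

Let qs : qC = s ^+ 2.
Proof. by rewrite -rmorphXn /= sqr_sqrtr // ltW. Qed.
Let s0 : s != 0.
Proof. by rewrite fmorph_eq0 sqrtr_eq0 -ltNge. Qed.

Let q21 : s ^+ 4 - 1 != 0.
Proof.
rewrite subr_eq0 -[4%N]/(2 * 2)%N exprM -qs -rmorphXn -(rmorph1 (real_complex R)).
rewrite (inj_eq (fmorph_inj _)) sqrf_eq1 negb_or q_neq1 /=.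
by rewrite gt_eqF // (lt_trans _ q_gt0) // oppr_lt0.
Qed.

Lemma rel_cl t u : s3_rel q t u -> cl t = cl u.
Proof. by move=> H; apply/palg_classP; exact: ac_rel. Qed.

Lemma r_ac : a * c = qC *: (c * a).
Proof. by have := rel_cl (s3_ac q); rewrite palg_classM palg_classZ palg_classM. Qed.
Lemma r_csas : cs * as_ = qC *: (as_ * cs).
Proof. by have := rel_cl (s3_csas q); rewrite palg_classM palg_classZ palg_classM. Qed.
Lemma r_acs : a * cs = qC *: (cs * a).
Proof. by have := rel_cl (s3_acs q); rewrite palg_classM palg_classZ palg_classM. Qed.
Lemma r_cas : c * as_ = qC *: (as_ * c).
Proof. by have := rel_cl (s3_cas q); rewrite palg_classM palg_classZ palg_classM. Qed.
Lemma r_ccs : c * cs = cs * c.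
Proof. by have := rel_cl (s3_ccs q); rewrite !palg_classM. Qed.
Lemma r_asa : as_ * a = 1 - cs * c.
Proof. by have := rel_cl (s3_asa q); rewrite palg_classD !palg_classM palg_class1 => <-; rewrite addrK. Qed.
Lemma r_aas : a * as_ = 1 - qC ^+ 2 *: (cs * c).
Proof. by have := rel_cl (s3_aas q); rewrite palg_classD palg_classZ !palg_classM palg_class1 => <-; rewrite -r_ccs addrK. Qed.

Definition gen (g : s3_gen) : S := cl (TGen g).
Definition wt (r : C) (g : s3_gen) : C := if g is (s3_a | s3_c) then r^-1 else r.

Fixpoint kT (r : C) (t : term) : S :=
  match t with
  | TGen g => wt r g *: gen g
  | TCst k => k *: 1
  | TAdd t u => kT r t + kT r u
  | TMul t u => kT r t * kT r u
  end.

Lemma kT_cong r : r != 0 -> forall t u, alg_cong (s3_rel q) t u -> kT r t = kT r u.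
Proof.
move=> r0 t u; elim=> /=.
- move=> {}t {}u [] /=; rewrite /gen -?/a -?/as_ -?/c -?/cs -?scalerAl -?scalerAr ?mul1r ?scale1r ?scalerA;
   rewrite ?r_ac ?r_csas ?r_acs ?r_cas ?r_ccs ?r_asa ?r_aas ?scalerA ?(mulfV r0,mulVf r0) ?mulfK ?mulr1 ?scale1r ?subrK ?addrNK //;
   by congr (_ *: _); field.
- by [].
- by move=> ? ? _ ->.
- by move=> ? ? ? _ -> _ ->.
- by move=> ? ? ? ? _ -> _ ->.
- by move=> ? ? ? ? _ -> _ ->.
- by move=> *; rewrite addrA.
- by move=> *; rewrite addrC.
- by move=> *; rewrite scale0r add0r.
- by move=> *; rewrite scaleN1r mulN1r addNr scale0r.
- by move=> *; rewrite mulrA.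
- by move=> *; rewrite scale1r mul1r.
- by move=> *; rewrite mulrDl.
- by move=> *; rewrite mulrDr.
- by move=> *; rewrite scalerDl.
- by move=> *; rewrite -scalerAl mul1r scalerA.
- by move=> *; rewrite -scalerAl -scalerAr mul1r mulr1.
Qed.

Section D.
Variable g0 : s3_gen -> S.
Fixpoint dT (t : term) : S :=
  match t with
  | TGen g => g0 g
  | TCst k => 0
  | TAdd t u => dT t + dT u
  | TMul t u => dT t * kT s u + kT s^-1 t * dT u
  end.
Hypothesis dT_rel : forall t u, s3_rel q t u -> dT t = dT u.
Lemma dT_cong t u : alg_cong (s3_rel q) t u -> dT t = dT u.
Proof.
have si0 : s^-1 != 0 by rewrite invr_eq0.
elim=> /=.
- exact: dT_rel.
- by [].
- by move=> ? ? _ ->.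
- by move=> ? ? ? _ -> _ ->.
- by move=> ? ? ? ? _ -> _ ->.
- by move=> x x' y y' cx -> cy ->; rewrite (kT_cong s0 cy) (kT_cong si0 cx).
- by move=> *; rewrite addrA.
- by move=> *; rewrite addrC.
- by move=> *; rewrite add0r.
- by move=> *; rewrite mul0r add0r scaleN1r mulN1r addNr.
- by move=> *; rewrite mulrDl mulrDr !mulrA addrA.
- by move=> *; rewrite mul0r add0r scale1r mul1r.
- by move=> *; rewrite !mulrDl addrACA.
- by move=> *; rewrite !mulrDr addrACA.
- by move=> *; rewrite addr0.
- by move=> *; rewrite mul0r mulr0 addr0.
- by move=> *; rewrite mul0r mulr0 addr0 add0r -scalerAl -scalerAr mul1r mulr1.
Qed.
End D.

Definition gE g : S := match g with s3_a => - qC *: cs | s3_c => as_ | _ => 0 end.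
Definition gF g : S := match g with s3_as => c | s3_cs => - qC^-1 *: a | _ => 0 end.

Ltac norm := rewrite /gen -?/a -?/as_ -?/c -?/cs ?(mul0r,mulr0,addr0,add0r,scaler0)
  -?scalerAl -?scalerAr ?(mul0r,mulr0,addr0,add0r,scaler0,scale0r) ?mul1r ?scale1r ?scalerDr ?scalerA.

Lemma modeq (k1 k2 k3 k4 : C) (x y : S) :
 k1 = k3 -> k2 = k4 -> k1 *: x + k2 *: y = k3 *: x + k4 *: y.
Proof. by move=> -> ->. Qed.
Lemma modeq0 (k1 k2 : C) (x : S) :
 k1 + k2 = 0 -> k1 *: x + k2 *: x = 0.
Proof. by rewrite -scalerDl => ->; rewrite scale0r. Qed.

Lemma gE_rel t u : s3_rel q t u -> dT gE t = dT gE u.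
Proof.
case=> /=; norm; rewrite ?invrK ?invfV //.
- rewrite r_aas r_asa -r_ccs !scalerBr !scalerA addrCA [RHS]addrAC -!scaleNr -!addrA.
  rewrite -!scalerDl; apply: modeq; rewrite qs; field.
  + by rewrite s0.
  + by rewrite s0.
- by congr (_ *: _); rewrite qs; field.
- by congr (_ *: _); rewrite qs; field.
- by rewrite r_csas scalerA; congr (_ *: _); rewrite qs; field.
- by rewrite r_csas scalerA; apply: modeq0; rewrite qs; field.
- by rewrite r_csas scalerA; apply: modeq0; rewrite qs; field.
Qed.

Lemma gF_rel t u : s3_rel q t u -> dT gF t = dT gF u.
Proof.
case=> /=; norm; rewrite ?invrK //.
- rewrite r_aas r_asa r_ccs !scalerBr !scalerA addrAC -!scaleNr -!addrA [RHS]addrCA.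
  rewrite -!scalerDl; apply: modeq; rewrite qs; field.
  + by rewrite s0.
  + by rewrite s0.
- by congr (_ *: _); rewrite qs; field.
- by congr (_ *: _); rewrite qs; field.
- by rewrite r_ac scalerA; congr (_ *: _); rewrite qs; field.
- by rewrite r_ac scalerA; apply: modeq0; rewrite qs; field.
- by rewrite r_ac scalerA; apply: modeq0; rewrite qs; field.
Qed.

Let si0 : s^-1 != 0. Proof. by rewrite invr_eq0. Qed.

Definition oK r (f : S) : S := kT r (repr f).
Definition oD g0 (f : S) : S := dT g0 (repr f).

Lemma oK_cl r t : r != 0 -> oK r (cl t) = kT r t.
Proof. by move=> r0; apply: kT_cong r0 _ _ _; exact: palg_repr. Qed.
Lemma oE_cl t : oD gE (cl t) = dT gE t.
Proof. by apply: dT_cong gE_rel _ _ _; exact: palg_repr. Qed.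
Lemma oF_cl t : oD gF (cl t) = dT gF t.
Proof. by apply: dT_cong gF_rel _ _ _; exact: palg_repr. Qed.

Lemma oKD r f g : r != 0 -> oK r (f + g) = oK r f + oK r g.
Proof.
by move=> r0; elim/palg_ind: f => t; elim/palg_ind: g => u; rewrite -palg_classD !oK_cl.
Qed.
Lemma oKM r f g : r != 0 -> oK r (f * g) = oK r f * oK r g.
Proof.
by move=> r0; elim/palg_ind: f => t; elim/palg_ind: g => u; rewrite -palg_classM !oK_cl.
Qed.
Lemma oKZ r k f : r != 0 -> oK r (k *: f) = k *: oK r f.
Proof.
by move=> r0; elim/palg_ind: f => t; rewrite -palg_classZ !oK_cl //= -scalerAl mul1r.
Qed.
Lemma oED f g : oD gE (f + g) = oD gE f + oD gE g.
Proof. by elim/palg_ind: f => t; elim/palg_ind: g => u; rewrite -palg_classD !oE_cl. Qed.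
Lemma oFD f g : oD gF (f + g) = oD gF f + oD gF g.
Proof. by elim/palg_ind: f => t; elim/palg_ind: g => u; rewrite -palg_classD !oF_cl. Qed.
Lemma oEZ k f : oD gE (k *: f) = k *: oD gE f.
Proof. by elim/palg_ind: f => t; rewrite -palg_classZ !oE_cl /= mul0r add0r -scalerAl mul1r. Qed.
Lemma oFZ k f : oD gF (k *: f) = k *: oD gF f.
Proof. by elim/palg_ind: f => t; rewrite -palg_classZ !oF_cl /= mul0r add0r -scalerAl mul1r. Qed.
Lemma oEM f g : oD gE (f * g) = oD gE f * oK s g + oK s^-1 f * oD gE g.
Proof. by elim/palg_ind: f => t; elim/palg_ind: g => u; rewrite -palg_classM !oE_cl !oK_cl. Qed.
Lemma oFM f g : oD gF (f * g) = oD gF f * oK s g + oK s^-1 f * oD gF g.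
Proof. by elim/palg_ind: f => t; elim/palg_ind: g => u; rewrite -palg_classM !oF_cl !oK_cl. Qed.

Local Opaque oK oD.
Definition oG (g : uq_gen) : S -> S :=
  match g with uq_E => oD gE | uq_F => oD gF | uq_K => oK s | uq_Ki => oK s^-1 end.
Lemma oGD h f g : oG h (f + g) = oG h f + oG h g.
Proof. by case: h; rewrite /= ?oED ?oFD ?oKD. Qed.
Lemma oGZ h k f : oG h (k *: f) = k *: oG h f.
Proof. by case: h; rewrite /= ?oEZ ?oFZ ?oKZ. Qed.
Lemma oG0 h : oG h 0 = 0.
Proof. by rewrite -(scale0r (0 : S)) oGZ !scale0r. Qed.

Lemma oK0 : oK s 0 = 0. Proof. exact: (oG0 uq_K). Qed.
Lemma oE0 : oD gE 0 = 0. Proof. exact: (oG0 uq_E). Qed.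
Lemma oF0 : oD gF 0 = 0. Proof. exact: (oG0 uq_F). Qed.

Lemma oK1 r : r != 0 -> oK r 1 = 1.
Proof. by move=> r0; rewrite -palg_class1 oK_cl //= palg_class1 scale1r. Qed.
Lemma oE1 : oD gE 1 = 0. Proof. by rewrite -palg_class1 oE_cl. Qed.
Lemma oF1 : oD gF 1 = 0. Proof. by rewrite -palg_class1 oF_cl. Qed.
Lemma oKa r : r != 0 -> oK r a = r^-1 *: a. Proof. by move=> r0; rewrite oK_cl. Qed.
Lemma oKc r : r != 0 -> oK r c = r^-1 *: c. Proof. by move=> r0; rewrite oK_cl. Qed.
Lemma oKas r : r != 0 -> oK r as_ = r *: as_. Proof. by move=> r0; rewrite oK_cl. Qed.
Lemma oKcs r : r != 0 -> oK r cs = r *: cs. Proof. by move=> r0; rewrite oK_cl. Qed.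
Lemma oEg g : oD gE (gen g) = gE g. Proof. by rewrite oE_cl. Qed.
Lemma oFg g : oD gF (gen g) = gF g. Proof. by rewrite oF_cl. Qed.
Lemma oKg r g : r != 0 -> oK r (gen g) = wt r g *: gen g.
Proof. by move=> r0; rewrite oK_cl. Qed.

Lemma S_ind (P : S -> Prop) :
  (forall g, P (gen g)) -> P 1 -> (forall k f, P f -> P (k *: f)) ->
  (forall f g, P f -> P g -> P (f + g)) ->
  (forall f g, P f -> P g -> P (f * g)) -> forall f, P f.
Proof.
move=> Pg P1 PZ PD PM; elim/palg_ind; elim.
- exact: Pg.
- by move=> k; rewrite palg_classC; exact: PZ.
- by move=> t Pt u Pu; rewrite palg_classD; exact: PD.
- by move=> t Pt u Pu; rewrite palg_classM; exact: PM.
Qed.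

Lemma oKKi r f : r != 0 -> oK r (oK r^-1 f) = f.
Proof.
move=> r0; have ri0 : r^-1 != 0 by rewrite invr_eq0.
elim/S_ind: f => [g||k f|f g|f g].
- by rewrite oKg // oKZ // oKg // scalerA; case: g; rewrite /= ?invrK ?(mulfV r0, mulVf r0) scale1r.
- by rewrite !oK1.
- by move=> H; rewrite !oKZ // H.
- by move=> H H'; rewrite !oKD // H H'.
- by move=> H H'; rewrite !oKM // H H'.
Qed.

Lemma oKE f : oK s (oD gE f) = qC *: oD gE (oK s f).
Proof.
elim/S_ind: f => [g||k f|f g|f g].
- rewrite oKg // oEZ oEg; case: g; rewrite /= ?scaler0 ?oK0 //.
  + by rewrite oKZ // oKcs // !scalerA; congr (_ *: _); rewrite qs; field.
  + by rewrite /= oKas // scalerA; congr (_ *: _); rewrite qs; field.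
- by rewrite oK1 // oE1 scaler0; exact: (oG0 uq_K).
- by move=> H; rewrite !(oEZ, oKZ _ _ s0) H !scalerA mulrC.
- move=> H H'. rewrite (oED f g). rewrite (oKD f g s0).
 rewrite (oKD (oD gE f) _ s0).
 rewrite (oED (oK s f)).
 rewrite H.
 rewrite H'.
 by rewrite scalerDr.
- move=> H H'; rewrite oEM oKD // !oKM // oEM H H' scalerDr -!scalerAl -!scalerAr.
  by have H1 := oKKi f s0; have := oKKi f si0; rewrite invrK => H2; rewrite H1 H2.
Qed.
Lemma oKF f : oK s (oD gF f) = qC^-1 *: oD gF (oK s f).
Proof.
elim/S_ind: f => [g||k f|f g|f g].
- rewrite oKg // oFZ oFg; case: g; rewrite /= ?scaler0 ?oK0 //.
  + by rewrite oKc // scalerA; congr (_ *: _); rewrite qs; field.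
  + by rewrite oKZ // oKa // !scalerA; congr (_ *: _); rewrite qs; field.
- by rewrite oK1 // oF1 scaler0; exact: (oG0 uq_K).
- by move=> H; rewrite !(oFZ, oKZ _ _ s0) H !scalerA mulrC.
- by move=> H H'; rewrite (oFD f g) (oKD f g s0) (oKD (oD gF f) _ s0) (oFD (oK s f)) H H' scalerDr.
- move=> H H'; rewrite oFM oKD // !oKM // oFM H H' scalerDr -!scalerAl -!scalerAr.
  by have H1 := oKKi f s0; have := oKKi f si0; rewrite invrK => H2; rewrite H1 H2.
Qed.
Let q0 : qC != 0. Proof. by rewrite qs expf_neq0. Qed.
Lemma oKiK f : oK s^-1 (oK s f) = f.
Proof. by rewrite -{2}[s]invrK oKKi. Qed.
Lemma oKiE f : oK s^-1 (oD gE f) = qC^-1 *: oD gE (oK s^-1 f).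
Proof.
rewrite -{1}(oKKi f s0) -[oD gE (oK s _)]scale1r -(mulVf q0) -scalerA -oKE.
by rewrite oKZ // oKiK.
Qed.
Lemma oKiF f : oK s^-1 (oD gF f) = qC *: oD gF (oK s^-1 f).
Proof.
rewrite -{1}(oKKi f s0) -[oD gF (oK s _)]scale1r -(mulfV q0) -scalerA -oKF.
by rewrite oKZ // oKiK.
Qed.

Let k0 := (qC - qC^-1)^-1.
Lemma oEF f : oD gE (oD gF f) - oD gF (oD gE f) =
  k0 *: (oK s (oK s f) - oK s^-1 (oK s^-1 f)).
Proof.
have d0 : qC - qC^-1 != 0.
  rewrite qs; have -> : s ^+ 2 - (s ^+ 2)^-1 = (s ^+ 4 - 1) / s ^+ 2 by field.
  by rewrite mulf_neq0 // invr_eq0 expf_neq0.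
elim/S_ind: f => [g||k f|f g|f g].
- rewrite oEg oFg !(oKg, oKZ) // !scalerA -scalerBl scalerA.
  have kE : k0 * (s^-1 * s^-1 - s * s) = -1.
    rewrite -invfM -expr2 -qs -opprB mulrN /k0 mulVf //.
  have kE' : k0 * (s * s - s^-1 * s^-1) = 1 by rewrite -opprB mulrN kE opprK.
  case: g; rewrite /= ?invrK ?kE ?kE' ?scaleN1r ?scale1r ?oE0 ?oF0 ?sub0r ?subr0 ?oEZ ?oFZ.
  + by rewrite (oFg s3_cs) /= scalerA mulNr mulrN mulfV // opprK scale1r.
  + by rewrite (oEg s3_c).
  + by rewrite (oFg s3_as).
  + by rewrite (oEg s3_a) /= scalerA mulNr mulrN mulVf // opprK scale1r.
- by rewrite oE1 oF1 !oK1 // oE0 oF0 !subrr scaler0.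
- by move=> H; rewrite !(oEZ,oFZ,oKZ) // -!scalerBr H !scalerA mulrC.
- move=> H H'; rewrite (oFD f g) (oED (oD gF f)) (oED f g) (oFD (oD gE f)).
  rewrite (oKD f g s0) (oKD (oK s f) _ s0) (oKD f g si0) (oKD (oK s^-1 f) _ si0).
  by rewrite !opprD addrACA [in RHS]addrACA scalerDr -H -H'.
- move=> H H'; rewrite (oFM f g) (oED (_ * _)) (oEM (oD gF f)) (oEM (oK s^-1 f)).
  rewrite (oEM f g) (oFD (_ * _)) (oFM (oD gE f)) (oFM (oK s^-1 f)).
  rewrite (oKM f g s0) (oKM (oK s f) _ s0) (oKM f g si0) (oKM (oK s^-1 f) _ si0).
  have -> : oK s^-1 (oD gF f) * oD gE (oK s g) = oD gF (oK s^-1 f) * oK s (oD gE g).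
    by rewrite oKiF oKE -scalerAl -scalerAr.
  have -> : oK s^-1 (oD gE f) * oD gF (oK s g) = oD gE (oK s^-1 f) * oK s (oD gF g).
    by rewrite oKiE oKF -scalerAl -scalerAr.
  set A := oK s (oK s g); set B := oK s^-1 (oK s^-1 f).
  set X := oD gF (oK s^-1 f) * _; set Y := oD gE (oK s^-1 f) * _.
  have -> : oK s (oK s f) * A - B * oK s^-1 (oK s^-1 g) =
     (oK s (oK s f) - B) * A + B * (A - oK s^-1 (oK s^-1 g)).
    by rewrite mulrBl mulrBr addrA subrK.
  rewrite scalerDr scalerAl scalerAr -H -H' mulrBl mulrBr.
  exact: grp.
Qed.

Fixpoint aT (t : ncterm C uq_gen) (f : S) : S :=
  match t with
  | TGen g => oG g f
  | TCst k => k *: f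
  | TAdd t u => aT t f + aT u f
  | TMul t u => aT t (aT u f)
  end.
Lemma aTD t f g : aT t (f + g) = aT t f + aT t g.
Proof.
elim: t f g => [h|k|t Ht u Hu|t Ht u Hu] f g /=.
- exact: oGD. - exact: scalerDr. - by rewrite Ht Hu addrACA. - by rewrite Hu Ht.
Qed.
Lemma aTZ t k f : aT t (k *: f) = k *: aT t f.
Proof.
elim: t f => [h|l|t Ht u Hu|t Ht u Hu] f /=.
- exact: oGZ. - by rewrite !scalerA mulrC. - by rewrite Ht Hu scalerDr. - by rewrite Hu Ht.
Qed.
Lemma aT_cong t u : alg_cong (uq_rel q) t u -> forall f, aT t f = aT u f.
Proof.
elim=> /=.
- move=> {}t {}u [] f /=; rewrite ?scale1r ?scaleN1r.
  + exact: oKKi. + exact: oKiK. + exact: oKE. + exact: oKiE. + exact: oKF. + exact: oKiF.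
  + exact: oEF.
- by [].
- by move=> ? ? _ H f; rewrite H.
- by move=> ? ? ? _ H _ H' f; rewrite H H'.
- by move=> ? ? ? ? _ H _ H' f; rewrite H H'.
- by move=> ? ? ? ? _ H _ H' f; rewrite H' H.
- by move=> *; rewrite addrA.
- by move=> *; rewrite addrC.
- by move=> *; rewrite scale0r add0r.
- by move=> *; rewrite scaleN1r addNr scale0r.
- by [].
- by move=> *; rewrite scale1r.
- by [].
- by move=> *; rewrite aTD.
- by move=> *; rewrite scalerDl.
- by move=> *; rewrite scalerA.
- by move=> *; rewrite aTZ.
Qed.
Definition act0 (u : Uq q) (f : S) : S := aT (repr u) f.
Lemma act0_cl t f : act0 (palg_class _ t) f = aT t f.
Proof. by apply: aT_cong; exact: palg_repr. Qed.

Lemma uq_action_exists : inhabited (uq_action q).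
Proof.
split; apply: (@UqAction R q act0).
- by elim/palg_ind=> u; elim/palg_ind=> v f; rewrite -palg_classD !act0_cl.
- by move=> k; elim/palg_ind=> u f; rewrite -palg_classZ !act0_cl.
- by move=> *; exact: aTD.
- by move=> *; exact: aTZ.
- by move=> f; rewrite -palg_class1 act0_cl /= scale1r.
- by elim/palg_ind=> u; elim/palg_ind=> v f; rewrite -palg_classM !act0_cl.
- by move=> f g; rewrite !act0_cl /= oEM.
- by move=> f g; rewrite !act0_cl /= oFM.
- by move=> f g; rewrite !act0_cl /= oKM.
- by move=> f g; rewrite !act0_cl /= oKM.
- by rewrite act0_cl /= oE1.
- by rewrite act0_cl /= oF1.
- by rewrite act0_cl /= oK1.
- by rewrite act0_cl /= oK1.
all: rewrite act0_cl /=.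
- by rewrite oKa.
- by rewrite oKc.
- by rewrite oKas.
- by rewrite oKcs.
- by rewrite oKa ?invrK.
- by rewrite oKc ?invrK.
- by rewrite oKas.
- by rewrite oKcs.
- by rewrite (oEg s3_a).
- by rewrite (oEg s3_c).
- by rewrite (oEg s3_as).
- by rewrite (oEg s3_cs).
- by rewrite (oFg s3_a).
- by rewrite (oFg s3_c).
- by rewrite (oFg s3_as).
- by rewrite (oFg s3_cs).
Qed.

Lemma uq_action_unique (A B : uq_action q) u f : A u f = B u f.
Proof.
have HK h : A (UK q) h = B (UK q) h.
  elim/S_ind: h => [[]||k h|g h|g h].
  - by rewrite !uq_actK_a.
  - by rewrite !uq_actK_as.
  - by rewrite !uq_actK_c.
  - by rewrite !uq_actK_cs.
  - by rewrite !uq_actK_one.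
  - by rewrite !uq_actZr => ->.
  - by rewrite !uq_actDr => -> ->.
  - by rewrite !uq_actK_mul => -> ->.
have HKi h : A (UKi q) h = B (UKi q) h.
  elim/S_ind: h => [[]||k h|g h|g h].
  - by rewrite !uq_actKi_a.
  - by rewrite !uq_actKi_as.
  - by rewrite !uq_actKi_c.
  - by rewrite !uq_actKi_cs.
  - by rewrite !uq_actKi_one.
  - by rewrite !uq_actZr => ->.
  - by rewrite !uq_actDr => -> ->.
  - by rewrite !uq_actKi_mul => -> ->.
have HE h : A (UE q) h = B (UE q) h.
  elim/S_ind: h => [[]||k h|g h|g h].
  - by rewrite !uq_actE_a.
  - by rewrite !uq_actE_as.
  - by rewrite !uq_actE_c.
  - by rewrite !uq_actE_cs.
  - by rewrite !uq_actE_one.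
  - by rewrite !uq_actZr => ->.
  - by rewrite !uq_actDr => -> ->.
  - by rewrite !uq_actE_mul HK HKi => -> ->.
have HF h : A (UF q) h = B (UF q) h.
  elim/S_ind: h => [[]||k h|g h|g h].
  - by rewrite !uq_actF_a.
  - by rewrite !uq_actF_as.
  - by rewrite !uq_actF_c.
  - by rewrite !uq_actF_cs.
  - by rewrite !uq_actF_one.
  - by rewrite !uq_actZr => ->.
  - by rewrite !uq_actDr => -> ->.
  - by rewrite !uq_actF_mul HK HKi => -> ->.
elim/palg_ind: u => t; elim: t f => [[]|k|t Ht v Hv|t Ht v Hv] f.
- exact: HE.
- exact: HF.
- exact: HK.
- exact: HKi.
- by rewrite palg_classC !uq_actZl !uq_act1.
- by rewrite palg_classD !uq_actDl Ht Hv.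
- by rewrite palg_classM !uq_actM Hv Ht.
Qed.

End Action.

End UqAction_exists.

Inductive tdir := t_plus | t_minus | t_z.

Section Tangent.
Variables (R : realType) (q : R).
Local Notation C := R[i].
Local Notation qC := (real_complex R q).
Local Notation sqrtqC := (real_complex R (Num.sqrt q)).

Definition tX (d : tdir) : Uq q :=
  match d with
  | t_plus => sqrtqC *: (UE q * UK q)
  | t_minus => sqrtqC^-1 *: (UF q * UK q)
  | t_z => (1 - qC ^- 2)^-1 *: (1 - UK q ^+ 4)
  end.

Definition tsigma (d : tdir) : Uq q :=
  match d with t_plus | t_minus => UK q ^+ 2 | t_z => UK q ^+ 4 end.

Definition tangent : {pred Uq q} := fun X =>
  `[< exists x y z : C, X = x *: tX t_plus + y *: tX t_minus + z *: tX t_z >].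

Fact tangent_submod : submod_closed tangent.
Proof.
split=> [|k _ _ /asboolP[x [y [z ->]]] /asboolP[x' [y' [z' ->]]]].
  by apply/asboolP; exists 0, 0, 0; rewrite !scale0r !addr0.
apply/asboolP; exists (k * x + x'), (k * y + y'), (k * z + z').
by rewrite !scalerDr !scalerDl !scalerA addrACA; congr (_ + _); rewrite addrACA.
Qed.

HB.instance Definition _ :=
  GRing.isSubmodClosed.Build C (Uq q) tangent tangent_submod.

Record TS3q := TangentVector { ts_val : Uq q; _ : ts_val \in tangent }.

HB.instance Definition _ := [isSub for ts_val].
HB.instance Definition _ := [Choice of TS3q by <:].
HB.instance Definition _ := [SubChoice_isSubLmodule of TS3q by <:].

Fact tX_tangent d : tX d \in tangent.
Proof.
apply/asboolP; exists (if d is t_plus then 1 else 0),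
  (if d is t_minus then 1 else 0), (if d is t_z then 1 else 0).
by case: d; rewrite !scale0r scale1r ?(add0r, addr0).
Qed.

Definition tvec (d : tdir) : TS3q := TangentVector (tX_tangent d).

End Tangent.

(* Right modules over the noncommutative ring S are left modules over the      *)
(* converse ring S^c.                                                          *)
Definition rscale (S : nzRingType) (M : lmodType S^c) (m : M) (f : S) : M :=
  (f : S^c) *: m.

Notation "m *> f" := (rscale m f) (at level 40, left associativity).

Section Modules.
Variables (R : realType) (q : R).
Local Notation C := R[i].
Local Notation S := (S3q q).

Definition freeS3q (n : nat) : lmodType S^c := 'cV[S^c]_n.

Definition is_basis (M : lmodType S^c) (n : nat) (e : 'I_n -> M) : Prop :=
  forall m : M, exists! x : {ffun 'I_n -> S}, m = \sum_(i < n) e i *> x i.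

(* Complex scalars act on a right S-module through C 1 in S. *)
Record q_connection (act : uq_action q) (M : lmodType S^c) := QConnection {
  nabla :> TS3q q -> M -> M;
  nablaDl : forall X Y m, nabla (X + Y) m = nabla X m + nabla Y m;
  nablaZl : forall (k : C) X m, nabla (k *: X) m = nabla X m *> (k *: 1);
  nablaDr : forall X m1 m2, nabla X (m1 + m2) = nabla X m1 + nabla X m2;
  nablaZr : forall (k : C) X m, nabla X (m *> (k *: 1)) = nabla X m *> (k *: 1);
  nablaM : forall d m f, nabla (tvec q d) (m *> f) =
    nabla (tvec q d) m *> act (tsigma q d) f + m *> act (tX q d) f
}.

Record hermitian_form (M : lmodType S^c) := HermitianForm {
  herm :> M -> M -> S;
  hermMr : forall m1 m2 f, herm m1 (m2 *> f) = herm m1 m2 * f;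
  hermC : forall m1 m2, star (herm m1 m2) = herm m2 m1;
  hermDl : forall m1 m2 m3, herm (m1 + m2) m3 = herm m1 m3 + herm m2 m3
}.

Definition right_linear (M : lmodType S^c) (phi : M -> S) : Prop :=
  (forall m1 m2, phi (m1 + m2) = phi m1 + phi m2) /\
  (forall m f, phi (m *> f) = phi m * f).

Definition dual_module (M : lmodType S^c) : Type :=
  {phi : M -> S | right_linear phi}.

Fact herm_right_linear (M : lmodType S^c) (h : hermitian_form M) (m : M) :
  right_linear (h m).
Proof.
split=> [m1 m2|m' f]; last exact: hermMr.
by rewrite -hermC hermDl starD !hermC.
Qed.

Definition herm_hat (M : lmodType S^c) (h : hermitian_form M) (m : M) :
  dual_module M := exist _ (h m) (herm_right_linear h m).

Definition herm_invertible (M : lmodType S^c) (h : hermitian_form M) : Prop :=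
  bijective (herm_hat h).

Definition compatible (act : uq_action q) (M : lmodType S^c)
    (D : q_connection act M) (h : hermitian_form M) : Prop :=
  forall m1 m2 : M,
  [/\ act (tX q t_plus) (h m1 m2) =
        h m1 (D (tvec q t_plus) m2)
        - act (UK q ^+ 2) (h (D (tvec q t_minus) m1) m2),
      act (tX q t_minus) (h m1 m2) =
        h m1 (D (tvec q t_minus) m2)
        - act (UK q ^+ 2) (h (D (tvec q t_plus) m1) m2)
    & act (tX q t_z) (h m1 m2) =
        h m1 (D (tvec q t_z) m2)
        - act (UK q ^+ 4) (h (D (tvec q t_z) m1) m2)].

End Modules.

(* Main.v *)
Require Import Defs.
From mathcomp Require Import all_boot all_order all_algebra.
From mathcomp Require Import reals complex ring.
Import Order.TTheory GRing.Theory Num.Theory.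
Local Open Scope ring_scope.

(* The star operation f |-> f' intertwines the action as (K f)' = K^-1 f',     *)
(* (E f)' = -q F f' and (F f)' = -q^-1 E f', so that                           *)
(*   sigma_d ((X_d* f)') = - X_d f',                                           *)
(* where d* exchanges + and - and fixes z. With this identity both sides of    *)
(* the compatibility condition have the same twisted Leibniz expansion, so it  *)
(* may be tested on a basis, where it reads                                    *)
(*   X_d h_ij = G_d,ij - sigma_d ((G_d*,ji)'),   G_d,ij = h(e_i, D_d e_j).     *)
(* Its solutions are G_d = 1/2 X_d h + (a solution of the homogeneous          *)
(* equation), and K is invertible, which yields gamma and rho. Finally,        *)
(* G_d = (h_ij) Gamma_d, and (h^ij) is a two-sided inverse of (h_ij) because   *)
(* the adjoint of a left inverse of a hermitian matrix is a right inverse.     *)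

(** For a matrix A over the algebra let T_d A have entries [act (tsigma q d) (star (A j i))]. By
    [act_sigma_star] T_d is an involution, and by [act_sigma_star_tX] it sends X_{tdual d} h to -X_d
    h. On a basis ([compatible_basis]) compatibility reads X_d h = G_d - T_d G_{tdual d}, so half of
    X_d h is a particular solution, and the remainder satisfies Y_d = T_d Y_{tdual d}: Y_+ is free
    and determines Y_-, while Y_z is a fixed point of T_z. Stripping K from Y_+ and K^2 from Y_z
    leaves an arbitrary gamma and a hermitian rho. [herm_linv_rinv] allows passing between G and
    Gamma. *)

Definition tdual (d : tdir) : tdir :=
  match d with t_plus => t_minus | t_minus => t_plus | t_z => t_z end.

(** * The star operation and the twisted derivations *)

Section Action.
Variables (R : realType) (q : R) (act : uq_action q).
Implicit Types (f g : S3q q) (u : Uq q).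
Local Notation qC := (real_complex R q).
Local Notation K := (act (UK q)).
Local Notation Ki := (act (UKi q)).
Local Notation E := (act (UE q)).
Local Notation F := (act (UF q)).

Lemma conjc_real (r : R) : conjc (real_complex R r) = real_complex R r.
Proof. by rewrite /conjc /= oppr0. Qed.

Lemma conjc_realV (r : R) : conjc (real_complex R r)^-1 = (real_complex R r)^-1.
Proof. by rewrite -fmorphV conjc_real. Qed.

Lemma conjc_realN (r : R) : conjc (- real_complex R r) = - real_complex R r.
Proof. by rewrite -rmorphN conjc_real. Qed.

Lemma star0 : star (0 : S3q q) = 0.
Proof. by apply: (addrI (star (0 : S3q q))); rewrite -starD !addr0. Qed.

Lemma starN f : star (- f) = - star f.
Proof. by apply: (addrI (star f)); rewrite -starD !subrr star0. Qed.

Lemma star_sum (I : finType) (G : I -> S3q q) :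
  star (\sum_i G i) = \sum_i star (G i).
Proof. exact: (big_morph _ (@starD R q) star0). Qed.

Lemma act_r0 u : act u 0 = 0.
Proof. by apply: (addrI (act u 0)); rewrite -uq_actDr !addr0. Qed.

Lemma act_rN u f : act u (- f) = - act u f.
Proof. by apply: (addrI (act u f)); rewrite -uq_actDr !subrr act_r0. Qed.

Lemma act_l0 f : act 0 f = 0.
Proof. by apply: (addrI (act 0 f)); rewrite -uq_actDl !addr0. Qed.

Lemma act_lN u f : act (- u) f = - act u f.
Proof. by apply: (addrI (act u f)); rewrite -uq_actDl !subrr act_l0. Qed.

Lemma act_expS u n f : act (u ^+ n.+1) f = act u (act (u ^+ n) f).
Proof. by rewrite exprS uq_actM. Qed.

Lemma uq_rel_class s t : uq_rel q s t -> palg_class (uq_rel q) s = palg_class _ t.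
Proof. by move=> st; apply/palg_classP; exact: ac_rel. Qed.

Lemma actKiK f : Ki (K f) = f.
Proof.
have := uq_rel_class _ _ (uq_KiK q); rewrite palg_classM palg_class1 => H.
by rewrite -uq_actM H uq_act1.
Qed.

Lemma actKKi f : K (Ki f) = f.
Proof.
have := uq_rel_class _ _ (uq_KKi q); rewrite palg_classM palg_class1 => H.
by rewrite -uq_actM H uq_act1.
Qed.

Lemma actKE f : K (E f) = qC *: E (K f).
Proof.
have := uq_rel_class _ _ (uq_KE q); rewrite palg_classM palg_classZ palg_classM => H.
by rewrite -uq_actM H uq_actZl uq_actM.
Qed.

Lemma actKF f : K (F f) = qC^-1 *: F (K f).
Proof.
have := uq_rel_class _ _ (uq_KF q); rewrite palg_classM palg_classZ palg_classM => H.
by rewrite -uq_actM H uq_actZl uq_actM.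
Qed.

Lemma star_gens :
  (star (S3a q) = S3as q) * (star (S3as q) = S3a q) *
  (star (S3c q) = S3cs q) * (star (S3cs q) = S3c q).
Proof. by rewrite -star_a -star_c !starK. Qed.

Lemma star_actK f : star (K f) = Ki (star f).
Proof.
elim/UqAction_exists.S_ind: f => [[]||k f IH|f g IHf IHg|f g IHf IHg].
- by rewrite (uq_actK_a act) starZ star_gens uq_actKi_as conjc_realV.
- by rewrite (uq_actK_as act) starZ star_gens uq_actKi_a conjc_real.
- by rewrite (uq_actK_c act) starZ star_gens uq_actKi_cs conjc_realV.
- by rewrite (uq_actK_cs act) starZ star_gens uq_actKi_c conjc_real.
- by rewrite uq_actK_one star1 uq_actKi_one.
- by rewrite uq_actZr !starZ uq_actZr IH.
- by rewrite uq_actDr !starD uq_actDr IHf IHg.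
- by rewrite uq_actK_mul !starM uq_actKi_mul IHf IHg.
Qed.

Lemma star_actKi f : star (Ki f) = K (star f).
Proof. by rewrite -[LHS]actKKi -star_actK actKKi. Qed.

Hypothesis q_gt0 : 0 < q.

Let qC0 : qC != 0.
Proof. by rewrite fmorph_eq0 gt_eqF. Qed.

(** Star reverses products and exchanges K with K^-1, so it carries the Leibniz rule of E to that of
    F; only the generators fix the scalar. *)
Lemma star_actE f : star (E f) = - qC *: F (star f).
Proof.
elim/UqAction_exists.S_ind: f => [[]||k f IH|f g IHf IHg|f g IHf IHg].
- by rewrite (uq_actE_a act) starZ !star_gens uq_actF_as conjc_realN.
- by rewrite (uq_actE_as act) star_gens uq_actF_a star0 scaler0.
- rewrite (uq_actE_c act) !star_gens uq_actF_cs scalerA mulrNN mulfV //.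
  by rewrite scale1r.
- by rewrite (uq_actE_cs act) star_gens uq_actF_c star0 scaler0.
- by rewrite uq_actE_one star1 uq_actF_one star0 scaler0.
- by rewrite uq_actZr !starZ uq_actZr IH !scalerA mulrC.
- by rewrite uq_actDr !starD uq_actDr IHf IHg scalerDr.
- rewrite uq_actE_mul starD !starM star_actK star_actKi IHf IHg uq_actF_mul.
  by rewrite -scalerAr -scalerAl scalerDr addrC.
Qed.

Lemma star_actF f : star (F f) = - qC^-1 *: E (star f).
Proof.
have := star_actE (star f); rewrite starK => H.
by rewrite -[E _]starK H starZ -fmorphV conjc_realN fmorphV scalerA mulrNN mulVf // scale1r.
Qed.

Lemma act_sigmaM d f g :
  act (tsigma q d) (f * g) = act (tsigma q d) f * act (tsigma q d) g.
Proof. by case: d; rewrite /= !act_expS expr0 !uq_act1 !uq_actK_mul. Qed.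

Lemma act_sigma_star d f : act (tsigma q d) (star (act (tsigma q d) f)) = star f.
Proof.
by case: d; rewrite /= !act_expS expr0 !uq_act1 !star_actK !actKKi.
Qed.

(** The factor K in X_+ and X_- cancels the K^-1 of the coproduct, which leaves f untwisted. *)
Lemma act_tXM d f g :
  act (tX q d) (f * g) = f * act (tX q d) g + act (tX q d) f * act (tsigma q d) g.
Proof.
case: d => /=; rewrite !uq_actZl.
- rewrite !uq_actM uq_actK_mul uq_actE_mul actKiK.
  by rewrite scalerDr -scalerAl -scalerAr addrC.
- rewrite !uq_actM uq_actK_mul uq_actF_mul actKiK.
  by rewrite scalerDr -scalerAl -scalerAr addrC.
- rewrite -scalerAl -scalerAr -scalerDr !uq_actDl !uq_act1 !act_lN.
  by rewrite (act_sigmaM t_z) /= mulrBr mulrBl addrA subrK.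
Qed.

Let sqrtqC0 : real_complex R (Num.sqrt q) != 0.
Proof. by rewrite fmorph_eq0 sqrtr_eq0 -ltNge. Qed.

Let qCE : qC = real_complex R (Num.sqrt q) ^+ 2.
Proof. by rewrite -rmorphXn /= sqr_sqrtr // ltW. Qed.

(** Moving K^2 past E or F gives q^2 or q^-2; with the scalars of star and the normalisations by
    sqrt q, exactly -1 remains. *)
Lemma act_sigma_star_tX d f :
  act (tsigma q d) (star (act (tX q (tdual d)) f)) = - act (tX q d) (star f).
Proof.
case: d => /=; rewrite !uq_actZl starZ uq_actZr.
- rewrite !uq_actM conjc_realV star_actF star_actK !uq_actZr.
  rewrite !(actKE, uq_actZr) actKKi !scalerA -scaleNr; congr (_ *: _).
  by rewrite qCE; field.
- rewrite !uq_actM conjc_real star_actE star_actK !uq_actZr.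
  rewrite !(actKF, uq_actZr) actKKi !scalerA -scaleNr; congr (_ *: _).
  by rewrite qCE; field.
- rewrite !uq_actDl !uq_act1 !act_lN starD uq_actDr starN act_rN.
  rewrite (act_sigma_star t_z) -scalerN opprB; congr (_ *: _).
  have -> : 1 - qC ^- 2 = real_complex R (1 - q ^- 2).
    by rewrite rmorphB rmorph1 fmorphV rmorphXn.
  exact: conjc_realV.
Qed.
End Action.

(** * Reduction of compatibility to a basis *)

Section Forms.
Variables (R : realType) (q : R) (act : uq_action q) (q_gt0 : 0 < q).
Variables (M : lmodType (S3q q)^c) (D : q_connection act M) (h : hermitian_form M).
Implicit Types (m : M) (f g : S3q q).

Lemma hermDr m m1 m2 : h m (m1 + m2) = h m m1 + h m m2.
Proof. by have [] := herm_right_linear h m. Qed.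

Lemma herm0r m : h m 0 = 0.
Proof. by apply: (addrI (h m 0)); rewrite -hermDr !addr0. Qed.

Lemma herm_sumr n m (v : 'I_n -> M) (f : 'I_n -> S3q q) :
  h m (\sum_i v i *> f i) = \sum_i h m (v i) * f i.
Proof.
rewrite (big_morph _ (hermDr m) (herm0r m)).
by apply: eq_bigr => i _; rewrite hermMr.
Qed.

Lemma nabla0 X : D X 0 = 0.
Proof. by apply: (addrI (D X 0)); rewrite -nablaDr !addr0. Qed.

Definition compat_at d m1 m2 : Prop :=
  act (tX q d) (h m1 m2) =
    h m1 (D (tvec q d) m2) - act (tsigma q d) (h (D (tvec q (tdual d)) m1) m2).

Lemma compatible_dirs :
  compatible D h <-> forall d m1 m2, compat_at d m1 m2.
Proof.
split=> [H d m1 m2|H m1 m2]; first by case: (H m1 m2); case: d.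
by split; [exact: (H t_plus)|exact: (H t_minus)|exact: (H t_z)].
Qed.

(** Apply [tsigma q d] after star to the equation. This symmetry makes it enough to prove linearity
    in the second slot. *)
Lemma compat_at_star d m1 m2 : compat_at (tdual d) m2 m1 -> compat_at d m1 m2.
Proof.
have [dd sd] : tdual (tdual d) = d /\ tsigma q (tdual d) = tsigma q d by case: d.
rewrite /compat_at dd sd => H; apply: oppr_inj.
rewrite -[h m1 m2]Defs.hermC -act_sigma_star_tX // H starD starN uq_actDr act_rN.
by rewrite act_sigma_star !Defs.hermC opprB.
Qed.

Lemma compat_atDr d m m1 m2 :
  compat_at d m m1 -> compat_at d m m2 -> compat_at d m (m1 + m2).
Proof.
rewrite /compat_at => H1 H2.
by rewrite !(nablaDr, hermDr, uq_actDr) H1 H2 opprD addrACA.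
Qed.

Lemma compat_at0r d m : compat_at d m 0.
Proof. by rewrite /compat_at nabla0 !herm0r !act_r0 subrr. Qed.

Lemma compat_atMr d m1 m2 f : compat_at d m1 m2 -> compat_at d m1 (m2 *> f).
Proof.
rewrite /compat_at => H.
rewrite hermMr act_tXM H nablaM hermDr !hermMr act_sigmaM mulrBl.
by rewrite addrCA addrA.
Qed.

Lemma compat_at_sumr n d m (v : 'I_n -> M) (f : 'I_n -> S3q q) :
  (forall i, compat_at d m (v i)) -> compat_at d m (\sum_i v i *> f i).
Proof.
move=> H; apply: (big_ind (compat_at d m)); first exact: compat_at0r.
  by move=> m1 m2; exact: compat_atDr.
by move=> i _; exact/compat_atMr/H.
Qed.

Lemma compatible_basis n (e : 'I_n -> M) : is_basis e ->
  compatible D h <-> forall d i j, compat_at d (e i) (e j).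
Proof.
move=> e_basis; split=> [/compatible_dirs H d i j|H]; first exact: H.
apply/compatible_dirs => d m1 m2.
have [f [-> _]] := e_basis m1; have [g [-> _]] := e_basis m2.
(* Expand the second slot, swap the slots, expand again, swap back. *)
apply: compat_at_sumr => j; apply: compat_at_star; apply: compat_at_sumr => i.
exact: compat_at_star.
Qed.

End Forms.

(** * Matrix inverses and the general solution *)

(** The entries do not commute, so hermiticity is what supplies the right inverse: star turns Hi H =
    1 into H Hi' = 1 for the adjoint Hi', and then Hi = Hi H Hi' = Hi'. *)
Lemma herm_linv_rinv (R : realType) (q : R) n (H Hi : 'M[S3q q]_n) :
  (forall i j, star (H i j) = H j i) -> Hi *m H = 1%:M -> H *m Hi = 1%:M.
Proof.
move=> H_herm HiH; pose Hi' := \matrix_(i, j) star (Hi j i) : 'M[S3q q]_n.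
have HHi' : H *m Hi' = 1%:M.
  apply/matrixP => i j; have /matrixP/(_ j i) := HiH; rewrite !mxE.
  move=> /(congr1 (@star R q)).
  rewrite star_sum eq_sym; have -> (b : bool) : star (b%:R : S3q q) = b%:R.
    by case: b; rewrite ?star1 ?star0.
  by move=> <-; apply: eq_bigr => k _; rewrite starM H_herm mxE.
by have -> : Hi = Hi' by rewrite -[Hi]mulmx1 -HHi' mulmxA HiH mul1mx.
Qed.

Theorem proposition3p5 (R : realType) (q : R) (q_gt0 : 0 < q) (q_neq1 : q != 1)
    (act : uq_action q) (n : nat) (n_ge1 : (1 <= n)%N)
    (e : 'I_n -> freeS3q q n) (e_basis : is_basis e)
    (D : q_connection act (freeS3q q n))
    (Gamma : tdir -> 'I_n -> 'I_n -> S3q q)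
    (GammaP : forall (d : tdir) (i : 'I_n),
      D (tvec q d) (e i) = \sum_(j < n) e j *> Gamma d j i)
    (h : hermitian_form (freeS3q q n)) (h_inv : herm_invertible h)
    (hi : 'I_n -> 'I_n -> S3q q)
    (hiP : forall i k : 'I_n,
      \sum_(j < n) hi i j * h (e j) (e k) = (i == k)%:R) :
  compatible D h <->
  exists gamma rho : 'I_n -> 'I_n -> S3q q,
    (forall i j : 'I_n, star (rho i j) = rho j i) /\
    (forall i j : 'I_n,
      [/\ Gamma t_plus i j = \sum_(k < n) hi i k *
            ((2^-1 : R[i]) *: act (tX q t_plus) (h (e k) (e j))
             + act (UK q) (gamma k j)),
          Gamma t_minus i j = \sum_(k < n) hi i k *
            ((2^-1 : R[i]) *: act (tX q t_minus) (h (e k) (e j))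
             + act (UK q) (star (gamma j k)))
        & Gamma t_z i j = \sum_(k < n) hi i k *
            ((2^-1 : R[i]) *: act (tX q t_z) (h (e k) (e j))
             + act (UK q ^+ 2) (rho k j))]).
Proof.
pose G d i j := h (e i) (D (tvec q d) (e j)).
pose K := act (UK q); pose Ki := act (UKi q).
have GE d i j : G d i j = \sum_k h (e i) (e k) * Gamma d k j.
  by rewrite /G GammaP herm_sumr.
(* As matrices G = H Gamma, so multiplying by the two-sided inverse of H turns each formula for
   Gamma into one for G. *)
have Gamma_eq d (W : 'I_n -> 'I_n -> S3q q) :
    (forall i j, Gamma d i j = \sum_k hi i k * W k j) <->
    forall i j, G d i j = W i j.
  pose H := \matrix_(i, j) h (e i) (e j) : 'M[S3q q]_n.
  pose Hi := \matrix_(i, j) hi i j : 'M[S3q q]_n.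
  pose Wm := \matrix_(i, j) W i j; pose Gm := \matrix_(i, j) Gamma d i j.
  have HiH : Hi *m H = 1%:M.
    by apply/matrixP=> i k; rewrite !mxE -hiP; apply: eq_bigr => j _; rewrite !mxE.
  have HHi : H *m Hi = 1%:M.
    by apply: herm_linv_rinv HiH => i j; rewrite !mxE Defs.hermC.
  have HG i j : (H *m Gm) i j = G d i j.
    by rewrite GE mxE; apply: eq_bigr => k _; rewrite !mxE.
  have HiW i j : (Hi *m Wm) i j = \sum_k hi i k * W k j.
    by rewrite mxE; apply: eq_bigr => k _; rewrite !mxE.
  split=> eqn i j.
    have GmE : Gm = Hi *m Wm by apply/matrixP => k l; rewrite HiW mxE.
    by rewrite -HG GmE mulmxA HHi mul1mx mxE.
  have WmE : Wm = H *m Gm by apply/matrixP => k l; rewrite HG mxE.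
  by rewrite -HiW WmE mulmxA HiH mul1mx mxE.
have star_half (x : S3q q) : star ((2^-1 : R[i]) *: x) = (2^-1 : R[i]) *: star x.
  rewrite starZ; congr (_ *: _).
  have -> : 2^-1 = real_complex R 2^-1 by rewrite fmorphV rmorph_nat.
  exact: conjc_real.
have halves (x : S3q q) : (2^-1 : R[i]) *: x + (2^-1 : R[i]) *: x = x.
  rewrite -scalerDl; have -> : 2^-1 + 2^-1 = 1 :> R[i] by field.
  exact: scale1r.
have KKi x : K (Ki x) = x by exact: actKKi.
have sigmaE x : act (UK q ^+ 2) x = K (K x) by rewrite !act_expS expr0 uq_act1.
have sigmazE x : act (UK q ^+ 4) x = K (K (K (K x))).
  by rewrite !act_expS expr0 uq_act1.
have starK_ x : K (star (K x)) = star x by rewrite /K star_actK actKKi.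
have compatE d i j : compat_at R q act _ D h d (e i) (e j) <->
    act (tX q d) (h (e i) (e j)) = G d i j - act (tsigma q d) (star (G (tdual d) j i)).
  by rewrite /compat_at /G Defs.hermC.
have halfX d i j :
    act (tsigma q d) (star ((2^-1 : R[i]) *: act (tX q (tdual d)) (h (e j) (e i)))) =
      - ((2^-1 : R[i]) *: act (tX q d) (h (e i) (e j))).
  by rewrite star_half uq_actZr act_sigma_star_tX // Defs.hermC scalerN.
rewrite (compatible_basis _ _ _ q_gt0 _ _ _ _ _ e_basis).
split=> [compat|[gamma [rho [rho_herm]]]].
  have {}compat d i j := (compatE d i j).1 (compat d i j).
  pose Y d i j := G d i j - (2^-1 : R[i]) *: act (tX q d) (h (e i) (e j)).
  have YE d i j : G d i j = (2^-1 : R[i]) *: act (tX q d) (h (e i) (e j)) + Y d i j.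
    by rewrite /Y addrC subrK.
  (* Subtracting the particular solution leaves the homogeneous equation. *)
  have Y_star d i j : act (tsigma q d) (star (Y (tdual d) j i)) = Y d i j.
    rewrite /Y starD starN uq_actDr act_rN halfX opprK.
    by apply/eqP; rewrite eq_sym subr_eq -addrA halves compat addrC subrK.
  (* With Y_z = K^2 rho, the equation Y_z = K^4 star(Y_z^T) becomes rho = star(rho^T), since
     star(K^2 f) = K^-2 star f. *)
  exists (fun i j => Ki (Y t_plus i j)), (fun i j => Ki (Ki (Y t_z i j))); split.
    move=> i j; rewrite -(Y_star t_z j i) sigmazE !star_actKi.
    by rewrite /K /Ki !actKiK.
  move=> i j; split; move: i j; apply/Gamma_eq => i j.
  - by rewrite -/K KKi YE.
  - by rewrite star_actKi -/K -sigmaE (Y_star t_minus) YE.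
  - by rewrite sigmaE !KKi YE.
move=> H; have W d := (Gamma_eq d _).1.
have Gp : forall i j,
    G t_plus i j = (2^-1 : R[i]) *: act (tX q t_plus) (h (e i) (e j))
    + K (gamma i j).
  by apply: W => i j; case: (H i j).
have Gm : forall i j,
    G t_minus i j = (2^-1 : R[i]) *: act (tX q t_minus) (h (e i) (e j))
    + K (star (gamma j i)).
  by apply: W => i j; case: (H i j).
have Gz : forall i j,
    G t_z i j = (2^-1 : R[i]) *: act (tX q t_z) (h (e i) (e j))
    + act (UK q ^+ 2) (rho i j).
  by apply: W => i j; case: (H i j).
(* The gamma and rho terms cancel, and the two halves add up to X_d h. *)
case=> i j; apply/compatE => /=.
- rewrite Gp Gm starD uq_actDr (halfX t_plus) sigmaE starK_ starK.
  by rewrite opprD opprK addrACA halves subrr addr0.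
- rewrite Gp Gm starD uq_actDr (halfX t_minus) sigmaE starK_.
  by rewrite opprD opprK addrACA halves subrr addr0.
- rewrite !Gz starD uq_actDr (halfX t_z) sigmazE !sigmaE !starK_ rho_herm.
  by rewrite opprD opprK addrACA halves subrr addr0.
Qed.
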